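(* Let $(\beta_{\mu,\boldsymbol{\nu}})_{\mu\in\mathbb{R},\boldsymbol{\nu}}$ be a translation-invariant family of probability densities on $\mathbb{R}$, where $\mu$ is the mean of $\beta_{\mu,\boldsymbol{\nu}}$ and $\boldsymbol{\nu}$ is an additional parameter, included in $\mathcal{S}(\mathbb{R})$. Let $r_{\boldsymbol{\nu}}(\mu)$ be a real penalty which does not belong to $C^\infty(\mathbb{R})$ as a function of $\mu$ (for some $\boldsymbol{\nu}$). Then there is no prior $\alpha\in\mathcal{T}(\mathbb{R})$, even improper, such that $$\exists K\in\mathbb{R}:\quad r_{\boldsymbol{\nu}}(\mu)+K=\mathrm{KL}(\beta_{\mu,\boldsymbol{\nu}}\|\alpha)\quad\text{for all }\mu,\boldsymbol{\nu}.$$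
   Context: $\mathcal{S}(\mathbb{R})$ is the Schwartz space and $\mathcal{S}'(\mathbb{R})$ the space of tempered distributions. The family is translation-invariant if $\beta_{\mu,\boldsymbol{\nu}}(\theta)=\beta_{0,\boldsymbol{\nu}}(\theta-\mu)$ for all $\mu,\boldsymbol{\nu},\theta$. $\mathcal{T}(\mathbb{R})=\{\alpha : \ln(\alpha)\in\mathcal{S}'(\mathbb{R})\}$: nonnegative functions $\alpha$ whose logarithm is a locally integrable function defining a tempered distribution; ''even improper'' means that $\alpha$ is not required to be integrable. $\mathrm{Ent}(\beta)=-\int\ln(\beta)\,\beta$. For a density $\beta\in\mathcal{S}(\mathbb{R})$ and $\alpha\in\mathcal{T}(\mathbb{R})$, $\mathrm{KL}(\beta\|\alpha)=\int\ln(\beta/\alpha)\,\beta$ is read as $-\mathrm{Ent}(\beta)-\langle\ln\alpha,\beta\rangle$, with $\langle\cdot,\cdot\rangle$ the pairing of $\mathcal{S}'$ with $\mathcal{S}$. *)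

(* Defs.v *)
(* MathComp-Analysis *)
From HB Require Import structures.
From mathcomp Require Import all_boot all_order all_algebra.
From mathcomp Require Import all_classical all_reals all_analysis.

Set Implicit Arguments.
Unset Strict Implicit.
Unset Printing Implicit Defensive.

Import Order.TTheory GRing.Theory Num.Theory.
Import numFieldNormedType.Exports.

Local Open Scope classical_set_scope.
Local Open Scope ring_scope.

(* In ring_scope this notation otherwise denotes the derivative of polynomials. *)
Local Notation "f ^` ( n )" := (derive1n n f) : ring_scope.

Section smooth.
Context {R : realType}.
Implicit Types (f g : R -> R) (a : R) (m : nat).

Definition smooth f := forall m x, derivable (f^`(m)) x 1.

Lemma derive1n_smoothE a f g m : smooth f -> smooth g ->
  (fun x => a * f x + g x)^`(m) = (fun x => a * f^`(m) x + g^`(m) x).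
Proof.
move=> sf sg; elim: m => [//|m IH].
rewrite derive1nS IH; apply/funext => x.
rewrite derive1E (@deriveD _ _ _ (a \*: f^`(m)) (g^`(m))) //.
- by rewrite deriveZ // -!derive1E.
- exact: derivableZ.
Qed.

Lemma smooth_linear a f g : smooth f -> smooth g ->
  smooth (fun x => a * f x + g x).
Proof.
move=> sf sg m x; rewrite derive1n_smoothE //.
by apply: (@derivableD _ _ _ (a \*: f^`(m)) (g^`(m))) => //; exact: derivableZ.
Qed.

Lemma derive1n_zero m : ((fun=> 0) : R -> R)^`(m) = fun=> 0.
Proof.
elim: m => [//|m IH]; rewrite derive1nS IH; apply/funext => x.
exact: derive1_cst.
Qed.

Lemma smooth_zero : smooth (fun=> 0).
Proof. by move=> m x; rewrite derive1n_zero; exact: derivable_cst. Qed.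

End smooth.

Section schwartz_space.
Context {R : realType}.
Implicit Types f g : R -> R.

Definition schwartz_range (k m : nat) f : set R :=
  [set `|x ^+ k * f^`(m) x| | x in [set: R]].

Definition is_schwartz f :=
  smooth f /\ forall k m, has_ubound (schwartz_range k m f).

Definition schwartz_pred : {pred R -> R} := [pred f | `[< is_schwartz f >]].

Lemma schwartz_predP f : f \in schwartz_pred <-> is_schwartz f.
Proof. by rewrite /schwartz_pred unfold_in /=; split => /asboolP. Qed.

Lemma schwartz_submod_closed : submod_closed schwartz_pred.
Proof.
split.
  apply/schwartz_predP; split; first exact: smooth_zero.
  move=> k m; exists 0 => _ [x _ <-].
  by rewrite (derive1n_zero (R := R)) mulr0 normr0.
move=> a f g /schwartz_predP[sf bf] /schwartz_predP[sg bg].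
apply/schwartz_predP; split; first exact: smooth_linear.
move=> k m; have [B fB] := bf k m; have [C gC] := bg k m.
exists (`|a| * B + C) => _ [x _ <-].
rewrite (derive1n_smoothE a m sf sg) mulrDr mulrCA.
rewrite (le_trans (ler_normD _ _))// lerD//; last by apply: gC; exists x.
by rewrite normrM ler_wpM2l//; apply: fB; exists x.
Qed.

HB.instance Definition _ := GRing.isSubmodClosed.Build R (R -> R)
  schwartz_pred schwartz_submod_closed.

End schwartz_space.

Record schwartz (R : realType) := Schwartz {
  schwartz_val :> R -> R;
  schwartz_valP : schwartz_val \in schwartz_pred }.

HB.instance Definition _ (R : realType) := [isSub for @schwartz_val R].
HB.instance Definition _ (R : realType) := [Choice of schwartz R by <:].
HB.instance Definition _ (R : realType) :=
  [SubChoice_isSubLmodule of schwartz R by <:].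

Section schwartz_topology.
Context {R : realType}.
Local Notation S := (schwartz R).
Implicit Types f g h : S.

Definition schwartz_seminorm (k m : nat) f : R := sup (schwartz_range k m f).

Lemma schwartz_smooth f : smooth f.
Proof. by have /schwartz_predP[] := schwartz_valP f. Qed.

Lemma schwartz_seminorm_ub k m f x :
  `|x ^+ k * f^`(m) x| <= schwartz_seminorm k m f.
Proof.
have /schwartz_predP[_ /(_ k m) bf] := schwartz_valP f.
by apply: ub_le_sup => //; exists x.
Qed.

Lemma schwartz_seminorm_le k m f (c : R) :
  (forall x, `|x ^+ k * f^`(m) x| <= c) -> schwartz_seminorm k m f <= c.
Proof.
move=> fc; apply: ge_sup; first by exists `|0 ^+ k * f^`(m) 0|, 0.
by move=> _ [x _ <-].
Qed.

Lemma schwartz_seminorm0 k m : schwartz_seminorm k m (0 : S) = 0.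
Proof.
apply/le_anti/andP; split.
  apply: schwartz_seminorm_le => x.
  by rewrite (derive1n_zero (R := R)) mulr0 normr0.
exact: le_trans (schwartz_seminorm_ub k m 0 0).
Qed.

Lemma schwartz_seminormDZ k m (a : R) f g :
  schwartz_seminorm k m (a *: f + g) <=
  `|a| * schwartz_seminorm k m f + schwartz_seminorm k m g.
Proof.
apply: schwartz_seminorm_le => x.
rewrite (derive1n_smoothE a m (@schwartz_smooth f) (@schwartz_smooth g)).
rewrite mulrDr mulrCA (le_trans (ler_normD _ _))// lerD ?schwartz_seminorm_ub//.
by rewrite normrM ler_wpM2l// schwartz_seminorm_ub.
Qed.

Lemma schwartz_seminormN k m f :
  schwartz_seminorm k m (- f) = schwartz_seminorm k m f.
Proof.
have H g : schwartz_seminorm k m (- g) <= schwartz_seminorm k m g.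
  rewrite -scaleN1r -[_ *: g]addr0 (le_trans (schwartz_seminormDZ _ _ _ _ _))//.
  by rewrite schwartz_seminorm0 addr0 normrN1 mul1r.
by apply/le_anti; rewrite H -[X in _ X <= _]opprK H.
Qed.

Lemma schwartz_seminormD k m f g :
  schwartz_seminorm k m (f + g) <=
  schwartz_seminorm k m f + schwartz_seminorm k m g.
Proof.
by have := schwartz_seminormDZ k m 1 f g; rewrite scale1r normr1 mul1r.
Qed.

Definition schwartz_near (n : nat) (e : R) : set (S * S) :=
  [set fg | forall k m, (k <= n)%N -> (m <= n)%N ->
              schwartz_seminorm k m (fg.1 - fg.2) < e].

(* The uniform structure, hence the topology, generated by the seminorms. *)
Definition schwartz_entourage : set_system (S * S) :=
  [set A | exists n, exists2 e : R, 0 < e & schwartz_near n e `<=` A].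

Lemma schwartz_entourage_filter : Filter schwartz_entourage.
Proof.
split.
- by exists 0%N, 1.
- move=> A B [n [d d0 nA]] [p [e e0 pB]].
  exists (maxn n p), (Num.min d e); first by rewrite lt_min d0.
  move=> fg H; split; [apply: nA|apply: pB] => k m kn mn.
    have := H k m; rewrite !leq_max kn mn /= => /(_ isT isT).
    by rewrite lt_min => /andP[].
  have := H k m; rewrite !leq_max kn mn !orbT /= => /(_ isT isT).
  by rewrite lt_min => /andP[].
- by move=> A B AB [n [e e0 nA]]; exists n, e => //; exact: subset_trans AB.
Qed.

Local Open Scope relation_scope.

Lemma schwartz_entourage_diagonal A : schwartz_entourage A -> diagonal `<=` A.
Proof.
move=> [n [e e0 nA]] [f g] /diagonalP ->; apply: nA => k m _ _ /=.
by rewrite subrr schwartz_seminorm0.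
Qed.

Lemma schwartz_entourage_inv A : schwartz_entourage A -> schwartz_entourage A^-1.
Proof.
move=> [n [e e0 nA]]; exists n, e => // -[f g] H; apply: nA => k m kn mn /=.
by rewrite -schwartz_seminormN opprB; exact: H.
Qed.

Lemma schwartz_entourage_split A : schwartz_entourage A ->
  exists2 B, schwartz_entourage B & B \; B `<=` A.
Proof.
move=> [n [e e0 nA]]; exists (schwartz_near n (e / 2)).
  by exists n, (e / 2) => //; rewrite divr_gt0.
move=> [f h] [g /= fg gh]; apply: nA => k m kn mn /=.
rewrite -(subrKA g) (le_lt_trans (schwartz_seminormD _ _ _ _))//.
by rewrite [e]splitr ltrD//; [exact: fg|exact: gh].
Qed.

HB.instance Definition _ := isUniform.Build S
  schwartz_entourage_filter schwartz_entourage_diagonal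
  schwartz_entourage_inv schwartz_entourage_split.

End schwartz_topology.

Section tempered_distributions.
Context {R : realType}.
Local Notation mu := (@completed_lebesgue_measure R).
Implicit Types (T : schwartz R -> R) (g : R -> \bar R).

(* Densities and priors being real-valued, real test functions are enough. *)
Definition tempered_distribution T := scalar T /\ continuous T.

Definition compactly_supported (f : R -> R) :=
  compact (closure [set x | f x != 0]).

(* The library's [locally_integrable] is for real-valued Borel functions. The
   completed measure makes every Lebesgue measurable prior admissible. *)
Definition locally_integrable_ext g :=
  forall K : set R, compact K -> mu.-integrable K g.

Definition distribution_of g T :=
  [/\ tempered_distribution T, locally_integrable_ext g &
      forall phi : schwartz R, compactly_supported phi ->
        (T phi)%:E = (\int[mu]_x (g x * (phi x)%:E))%E].

(* At most one T qualifies, since C_c^oo is dense in S; the integral of g * phi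
   need not exist when the support of phi is not compact. *)
Definition pairing g (phi : schwartz R) : R :=
  xget (fun=> 0) [set T | distribution_of g T] phi.

End tempered_distributions.

Section entropy.
Context {R : realType}.
Local Notation mu := (@lebesgue_measure R).
Implicit Types (alpha f : R -> R).

Definition probability_density f :=
  (forall x, 0 <= f x) /\ (\int[mu]_x (f x)%:E = 1)%E.

Definition density_mean f : \bar R := (\int[mu]_x (x * f x)%:E)%E.

(* [lne] has value -oo at 0, whereas [ln 0 = 0]: the zero set of alpha thus has
   to be negligible for log_of alpha to be locally integrable. *)
Definition log_of alpha : R -> \bar R := fun x => lne (alpha x)%:E.

Definition log_tempered alpha :=
  (forall x, 0 <= alpha x) /\ exists T, distribution_of (log_of alpha) T.

(* The convention 0 ln 0 = 0 is built in. *)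
Definition Ent f : \bar R := (- \int[mu]_x (ln (f x) * f x)%:E)%E.

Definition KL (beta : schwartz R) alpha : \bar R :=
  (- Ent beta - (pairing (log_of alpha) beta)%:E)%E.

End entropy.

(* Main.v *)
(* Write beta_mu for the translate of b = beta_0. The entropy of beta_mu does not
   depend on mu, so that r(mu) = const - T(beta_mu), where T is the tempered
   distribution defined by ln alpha. In the Schwartz topology the difference
   quotients of mu |-> beta_mu converge to minus the translate of b', hence
   mu |-> T(beta_mu) has derivative mu |-> - T(b' translated by mu). As b' is
   again a Schwartz function, induction makes r smooth, a contradiction. *)
Require Import Defs.
From HB Require Import structures.
From mathcomp Require Import all_boot all_order all_algebra.
From mathcomp Require Import all_classical all_reals all_analysis.
From mathcomp Require Import measurable_realfun ring.

Import Order.TTheory GRing.Theory Num.Theory.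
Import numFieldNormedType.Exports.

Local Open Scope classical_set_scope.
Local Open Scope ring_scope.

(** * Translates of smooth and of rapidly decreasing functions *)

Section translation.
Context {R : realType}.
Implicit Types (f g : R -> R) (c h k x y : R) (m n : nat).

Lemma derive1_translate f c :
  derive1 (fun x => f (x - c)) = (fun x => derive1 f (x - c)).
Proof.
by apply/funext => x; rewrite /derive1; under eq_fun do rewrite -addrA.
Qed.

Lemma derive1n_translate f c m :
  derive1n m (fun x => f (x - c)) = (fun x => derive1n m f (x - c)).
Proof. by elim: m => // m IH; rewrite !derive1nS IH derive1_translate. Qed.

Lemma derivable_translate f c x :
  derivable f (x - c) 1 -> derivable (fun y => f (y - c)) x 1.
Proof.
by rewrite /derivable /=; under [in X in _ -> X]eq_fun do rewrite -addrA.
Qed.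

Lemma derive1nD f m n : derive1n m (derive1n n f) = derive1n (m + n) f.
Proof. by rewrite /derive1n iterD. Qed.

Lemma smooth_derive1n f n : smooth f -> smooth (derive1n n f).
Proof. by move=> sf m x; rewrite derive1nD. Qed.

Lemma smooth_translate f c : smooth f -> smooth (fun x => f (x - c)).
Proof.
by move=> sf m x; rewrite derive1n_translate; exact: derivable_translate.
Qed.

Lemma smooth_continuous f : smooth f -> continuous f.
Proof.
by move=> sf x; apply/differentiable_continuous/derivable1_diffP/(sf 0).
Qed.

Lemma smooth_cst c : smooth (fun=> c).
Proof.
have derive1n_cst m : derive1n m.+1 (fun=> c) = fun=> 0.
  elim: m => [|m IH]; last first.
    by rewrite derive1nS IH; apply/funext => x; rewrite derive1_cst.
  by apply/funext => x; rewrite derive1n1 derive1_cst.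
by case=> [|m] x; rewrite ?derive1n_cst; exact: derivable_cst.
Qed.

(** Recording the offset [s] from [y], rather than an intermediate point, treats both signs of [h]
    at once. The bound on [s] lets the lemma be applied again with [s] as the increment. *)
Lemma MVT_increment f y h : (forall x, derivable f x 1) ->
  exists2 s, `|s| <= `|h| & f (y + h) - f y = derive1 f (y + s) * h.
Proof.
move=> df.
have dfE x : is_derive x 1 f (derive1 f x).
  by rewrite derive1E; exact/derivableP.
have cf (A : set R) : {within A, continuous f}.
  apply: continuous_subspaceT => x.
  exact/differentiable_continuous/derivable1_diffP.
have [h0|h0] := leP 0 h.
  have [|c] := MVT_segment (a := y) (b := y + h) _ (fun x _ => dfE x) (cf _).
    by rewrite lerDl.
  rewrite in_itv /= => /andP[yc ch] ->; exists (c - y).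
    by rewrite ger0_norm ?subr_ge0// ger0_norm// lerBlDl.
  by rewrite subrKC [y + h]addrC addrK.
have [|c] := MVT_segment (a := y + h) (b := y) _ (fun x _ => dfE x) (cf _).
  by rewrite gerDl ltW.
rewrite in_itv /= => /andP[yc ch] E; exists (c - y).
  by rewrite ler0_norm ?subr_le0// ltr0_norm// lerN2 lerBrDl.
by rewrite subrKC -opprB E opprD addrA subrr add0r mulrN opprK.
Qed.

(* The bound is uniform in the shift k, because the remainder of a difference
   quotient is evaluated at an unknown intermediate shift. *)
Lemma rapid_decay_translate g :
  (forall n, exists C : R, forall x, `|x ^+ n * g x| <= C) ->
  forall c n, exists C : R, forall x k, `|k| <= c -> `|x ^+ n * g (x + k)| <= C.
Proof.
(* The induction generalises [g]: one factor x is split as (x + k) - k, and the function x * g x is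
   again rapidly decreasing. *)
move=> dg c n; elim: n g dg => [|n IH] g dg.
  by have [C gC] := dg 0; exists C => x k _; have := gC (x + k); rewrite !expr0.
have [A gA] := IH _ dg.
have [B gB] : exists C : R, forall x k, `|k| <= c ->
    `|x ^+ n * ((x + k) * g (x + k))| <= C.
  apply: (IH (fun x => x * g x)) => m; have [C gC] := dg m.+1.
  by exists C => x; rewrite mulrA -exprSr.
exists (B + c * A) => x k kc.
have -> : x ^+ n.+1 * g (x + k) =
    x ^+ n * ((x + k) * g (x + k)) - k * (x ^+ n * g (x + k)).
  by rewrite exprSr -{2}[x](addrK k) mulrBr mulrBl -!mulrA [_ * (k * _)]mulrCA.
rewrite (le_trans (ler_normB _ _))// lerD ?gB// normrM.
by rewrite ler_pM// gA.
Qed.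

End translation.

(** * Translation and differentiation in the Schwartz space *)

Section schwartz_translation.
Context {R : realType}.
Implicit Types (f : schwartz R) (c h x y : R) (k m n : nat).

Lemma schwartz_decay f m n : exists C : R,
  forall x, `|x ^+ n * derive1n m f x| <= C.
Proof. by exists (schwartz_seminorm n m f) => x; exact: schwartz_seminorm_ub. Qed.

Lemma schwartz_derive1_subproof f : derive1 f \in @schwartz_pred R.
Proof.
apply/schwartz_predP; split;
  first exact: (smooth_derive1n f 1 (@schwartz_smooth R f)).
move=> k m; have [C fC] := schwartz_decay f m.+1 k.
by exists C => _ [x _ <-]; rewrite -derive1n1 derive1nD addn1.
Qed.

Definition schwartz_derive1 f := Schwartz (schwartz_derive1_subproof f).

Lemma schwartz_translate_subproof c f :
  (fun x => f (x - c)) \in @schwartz_pred R.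
Proof.
apply/schwartz_predP; split; first exact/smooth_translate/schwartz_smooth.
move=> k m; have [C fC] := rapid_decay_translate _ (schwartz_decay f m) `|c| k.
by exists C => _ [x _ <-]; rewrite derive1n_translate fC ?normrN.
Qed.

Definition schwartz_translate c f := Schwartz (schwartz_translate_subproof c f).

Lemma derive1n_schwartzDZ (a : R) (f g : schwartz R) m :
  derive1n m (a *: f + g : schwartz R) =
  (fun x => a * derive1n m f x + derive1n m g x).
Proof.
exact: (derive1n_smoothE a m (@schwartz_smooth R f) (@schwartz_smooth R g)).
Qed.

Lemma derive1n_schwartzB (f g : schwartz R) m :
  derive1n m (f - g : schwartz R) =
  (fun x => derive1n m f x - derive1n m g x).
Proof.
rewrite -scaleN1r addrC derive1n_schwartzDZ.
by apply/funext => x; rewrite mulN1r addrC.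
Qed.

Lemma derive1n_schwartz_translate c f m :
  derive1n m (schwartz_translate c f) = (fun x => derive1n m f (x - c)).
Proof. exact: derive1n_translate. Qed.

Lemma derive1n_schwartz_derive1 f m :
  derive1n m (schwartz_derive1 f) = derive1n m.+1 f.
Proof. by rewrite -addn1 -derive1nD. Qed.

(** An entourage constrains only finitely many seminorms, so the corresponding conditions on [i] can
    be intersected within the filter. *)
Lemma cvg_schwartz {I : Type} (F : set_system I) {FF : Filter F}
    (u : I -> schwartz R) (f : schwartz R) :
  (forall k m, schwartz_seminorm k m (f - u i) @[i --> F] --> (0 : R)) ->
  u @ F --> f.
Proof.
move=> uf; apply/cvg_app_entourageP => A [n [e e0 nA]].
have H : \forall i \near F, forall k m : 'I_n.+1,
    schwartz_seminorm k m (f - u i) < e.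
  apply: filter_forall => k; apply: filter_forall => m.
  have /cvgrPdist_lt/(_ e e0) := uf k m; apply: filterS => i.
  by rewrite sub0r normrN; apply: le_lt_trans; exact: ler_norm.
apply: filterS H => i H; apply: nA => k m kn mn /=.
by have := H (Ordinal (kn : (k < n.+1)%N)) (Ordinal (mn : (m < n.+1)%N)).
Qed.

Lemma schwartz_seminorm_ge0 k m f : 0 <= schwartz_seminorm k m f.
Proof. exact: le_trans (schwartz_seminorm_ub k m f 0). Qed.

(** Two uses of the mean value theorem turn the error of the quotient, differentiated m times, into
    a value of the derivative of order m + 2 times an offset of size at most [|h|]. Decay uniform in
    the shift then bounds every seminorm of the error by a multiple of [|h|]. *)
Lemma schwartz_diff_quotient_cvg f c :
  h^-1 *: (schwartz_translate (h + c) f - schwartz_translate c f) @[h --> 0^'] -->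
  - schwartz_translate c (schwartz_derive1 f).
Proof.
apply: cvg_schwartz => k m.
(* The shift will be t - c with [|t| <= |h| <= 1], hence the radius [|c| + 1]. *)
have [C fC] := rapid_decay_translate _ (schwartz_decay f m.+2) (`|c| + 1) k.
apply/cvgrPdist_le => e e0.
have C0 : 0 <= C by rewrite (le_trans _ (fC 0 0 _))// normr0 addr_ge0.
near=> h.
have h0 : h != 0 by near: h; exact: nbhs_dnbhs_neq.
have h1 : `|h| <= 1.
  by near: h; apply: dnbhs0_le; exact: ltr01.
(* The denominator is C + 1 because C may vanish. *)
have he : `|h| <= e / (C + 1).
  by near: h; apply: dnbhs0_le; rewrite divr_gt0// ltr_wpDl//.
rewrite sub0r normrN ger0_norm ?schwartz_seminorm_ge0//.
apply: schwartz_seminorm_le => x.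
(* A zero summand brings the error into the shape [a *: f + g]. *)
rewrite -opprD -scaleN1r -[_ *: (_ + _)]addr0 derive1n_schwartzDZ.
rewrite derive1n_zero addr0 addrC derive1n_schwartzDZ derive1n_schwartzB.
rewrite !derive1n_schwartz_translate derive1n_schwartz_derive1.
have df n y : derivable (derive1n n f) y 1 by exact: (@schwartz_smooth R f).
have -> : x - (h + c) = x - c + - h by rewrite opprD addrCA addrC.
have [s sh ->] := MVT_increment (derive1n m f) (x - c) (- h) (df m).
have [t ts] := MVT_increment (derive1n m.+1 f) (x - c) s (df m.+1).
rewrite -!derive1nS => /eqP; rewrite subr_eq => /eqP ->.
rewrite normrN in sh.
have -> : x ^+ k * (-1 * (h^-1 * (((derive1n m.+2 f) (x - c + t) * s +
      derive1n m.+1 f (x - c)) * - h) + derive1n m.+1 f (x - c))) =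
    x ^+ k * derive1n m.+2 f (x + (t - c)) * s.
  rewrite -[x - c + t]addrA [- c + t]addrC; field.
  exact: h0.
rewrite normrM (@le_trans _ _ (C * (e / (C + 1))))//.
  rewrite ler_pM// ?(le_trans sh)// fC// addrC (le_trans (ler_normD _ _))//.
  by rewrite normrN lerD2l (le_trans ts)// (le_trans sh).
by rewrite mulrCA ger_pMr// ler_pdivrMr ?ltr_wpDl// mul1r lerDl.
Unshelve. all: by end_near.
Qed.

End schwartz_translation.

(** * Tempered distributions along the translates of a test function *)

Section tempered_translation.
Context {R : realType} (T : schwartz R -> R)
  (T_tempered : tempered_distribution T).
Implicit Types (f : schwartz R) (c x : R) (m : nat).

Lemma tempered_translate_cvg f c :
  h^-1 *: (T (schwartz_translate (h + c) f) - T (schwartz_translate c f))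
    @[h --> 0^'] --> - T (schwartz_translate c (schwartz_derive1 f)).
Proof.
have [Tlin Tcont] := T_tempered.
(* [T] is a bare function; bundling it as a scalar linear map gives access to the linearity
   rewrites. *)
pose TL := GRing.isLinear.Build _ _ _ _ T Tlin.
pose L : {scalar (schwartz R)} := HB.pack T TL.
have TE : T = L by [].
rewrite TE; under eq_fun do rewrite -linearB -linearZ.
rewrite -linearN.
exact: cvg_comp (schwartz_diff_quotient_cvg f c) (Tcont _).
Qed.

Lemma derivable_tempered_translate f c :
  derivable (fun x => T (schwartz_translate x f)) c 1.
Proof.
apply/cvg_ex; exists (- T (schwartz_translate c (schwartz_derive1 f))).
rewrite /=; under eq_fun do rewrite [_%:A]mulr1.
exact: tempered_translate_cvg.
Qed.

Lemma derive1_tempered_translate f :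
  derive1 (fun x => T (schwartz_translate x f)) =
  (fun x => - T (schwartz_translate x (schwartz_derive1 f))).
Proof.
by apply/funext => c; apply: cvg_lim => //; exact: tempered_translate_cvg.
Qed.

(** Each differentiation in the shift costs a sign and passes one derivative to the test function,
    so the form is stable under induction. *)
Lemma derive1n_tempered_translate f m :
  derive1n m (fun x => T (schwartz_translate x f)) =
  (fun x => (-1) ^+ m * T (schwartz_translate x (iter m schwartz_derive1 f))).
Proof.
elim: m => [|m IH]; first by apply/funext => x; rewrite expr0 mul1r.
rewrite derive1nS IH; apply/funext => x.
rewrite derive1Ml; last exact: derivable_tempered_translate.
by rewrite derive1_tempered_translate exprS mulN1r mulrN mulNr.
Qed.

Lemma smooth_tempered_translate f :
  smooth (fun x => T (schwartz_translate x f)).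
Proof.
move=> m x; rewrite derive1n_tempered_translate.
by apply: (@derivableZ _ _ _ (fun y => T _)); exact: derivable_tempered_translate.
Qed.

End tempered_translation.

(** * Translation invariance of the Lebesgue integral and of the entropy *)

Section entropy_translation.
Context {R : realType}.
Local Notation mu := (@lebesgue_measure R).
Implicit Types (c : R).

Lemma measurable_translate c :
  measurable_fun [set: measurableTypeR R]
    ((fun x => x - c) : _ -> measurableTypeR R).
Proof. exact: measurable_funB. Qed.

(** Lebesgue measure is determined by its values on half-open intervals, whose preimages are
    intervals of the same length. *)
Lemma lebesgue_measure_translate c (A : set R) : measurable A ->
  pushforward mu ((fun x => x - c) : _ -> measurableTypeR R) A = mu A.
Proof.
move=> mA; apply/esym/lebesgue_measure_unique => //=.
  exact: measurable_translate.
move=> _ _ [[a b]] _ <-.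
rewrite /pushforward.
rewrite [X in _ = mu X](_ : _ = `]a + c, b + c]%classic).
  rewrite !lebesgue_measure_itv/= !lte_fin ltrD2r.
  by case: ifP => // _; rewrite -!EFinB; congr EFin; ring.
by apply/seteqP; split => x /=; rewrite !in_itv/= ltrBrDr lerBlDr.
Qed.

(** Change of variables settles nonnegative functions; the positive and negative parts then give the
    general case, infinite integrals included. *)
Lemma integral_translate c (f : R -> \bar R) : measurable_fun [set: R] f ->
  (\int[mu]_x f (x - c)%R = \int[mu]_x f x)%E.
Proof.
have mc := measurable_translate c.
have ge0 g : measurable_fun [set: R] g -> (forall x, 0 <= g x)%E ->
    (\int[mu]_x g (x - c)%R = \int[mu]_x g x)%E.
  move=> mg g0; rewrite -[LHS](ge0_integral_pushforward mc mu measurableT mg)//.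
  by apply: eq_measure_integral => A mA _; exact: lebesgue_measure_translate.
move=> mf; rewrite integralE [RHS]integralE; congr (_ - _)%E.
- rewrite (funepos_comp f (fun x => x - c)).
  exact: (ge0 (f^\+)%E (measurable_funepos mf) (funepos_ge0 f)).
- rewrite (funeneg_comp f (fun x => x - c)).
  exact: (ge0 (f^\-)%E (measurable_funeneg mf) (funeneg_ge0 f)).
Qed.

Lemma Ent_translate c (f : R -> R) : measurable_fun [set: R] f ->
  Ent (fun x => f (x - c)) = Ent f.
Proof.
move=> mf; rewrite /Ent; congr (- _)%E.
apply: (integral_translate c (fun x => (ln (f x) * f x)%:E)).
apply/measurable_EFinP; apply: measurable_funM => //.
exact: measurableT_comp.
Qed.

End entropy_translation.

(** The hypothesis supplies a candidate, so [xget] returns a genuine distribution and not its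
    default value. *)
Lemma pairing_tempered (R : realType) (alpha : R -> R) :
  log_tempered alpha -> tempered_distribution (pairing (log_of alpha)).
Proof.
move=> [_ [T aT]]; rewrite /pairing.
by case: xgetP => [U _ []|/(_ T)].
Qed.

Theorem proposition2 (R : realType) (N : Type)
    (beta : R -> N -> schwartz R) (r : N -> R -> R)
    (beta_density : forall (mu : R) (nu : N), probability_density (beta mu nu))
    (beta_mean : forall (mu : R) (nu : N), density_mean (beta mu nu) = mu%:E)
    (beta_translation : forall (mu : R) (nu : N) (theta : R),
      beta mu nu theta = beta 0 nu (theta - mu))
    (r_not_smooth : exists nu : N, ~ smooth (r nu)) :
  ~ exists alpha : R -> R, log_tempered alpha /\
      exists K : R, forall (mu : R) (nu : N),
        (r nu mu + K)%:E = KL (beta mu nu) alpha.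
Proof.
move=> [alpha [alpha_tempered [K rK]]]; have [nu] := r_not_smooth; apply.
pose T := pairing (log_of alpha).
have betaE mu : beta mu nu = schwartz_translate mu (beta 0 nu).
  by apply: val_inj; apply/funext => x; exact: beta_translation.
have EntE mu : Ent (beta mu nu) = Ent (beta 0 nu).
  rewrite betaE; apply: Ent_translate; apply: continuous_measurable_fun.
  exact/smooth_continuous/schwartz_smooth.
(* The right-hand side has the shape expected by [smooth_linear], with a constant second summand. *)
have rE mu : r nu mu = -1 * T (schwartz_translate mu (beta 0 nu)) +
    (- fine (Ent (beta 0 nu)) - K).
  have := rK mu nu; rewrite /KL EntE -betaE -/T.
  (* An infinite entropy would make the divergence infinite, whereas it equals a real number; so
     [fine] loses nothing. *)
  case: (Ent _) => //= e [] /eqP; rewrite -subr_eq0 => /eqP E.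
  by apply/eqP; rewrite -subr_eq0 -E; apply/eqP; ring.
rewrite (funext rE); apply: smooth_linear.
  exact/smooth_tempered_translate/pairing_tempered.
exact: smooth_cst.
Qed.
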